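(* Let $\tau>0$, $d_i\ge0$ and $\tilde\psi_i>0$ for $i=1,\dots,N$ with $\sum_i d_i>0$. For $\varphi>0$ let $\pi_A=\pi_A(\varphi)>0$ be the equilibrium premium, i.e. the unique positive solution of $\pi_A=\varphi D_A(\pi_A)$. Then $D_A'(\pi_A)<0$, and the elasticity of the equilibrium premium with respect to $\varphi$ is $$\frac{d\log\pi_A}{d\log\varphi}=\frac{1}{1+\varphi\,|D_A'(\pi_A)|}\in(0,1).$$
   Context: There are finitely many operators $i=1,\dots,N$ with expected compliance shortfalls $d_i\ge0$ and normalized access-cost parameters $\tilde\psi_i>0$; $\tau>0$ is the cycle length. For $\pi\ge0$ define $$\lambda_i^*(\pi)=\frac1\tau W\!\left(\frac{d_i\pi\tau^2}{\tilde\psi_i}\right),\qquad D_A(\pi)=\sum_i d_i e^{-\lambda_i^*(\pi)\tau},$$ where $W$ is the Lambert $W$ function on $[0,\infty)$, the inverse of $y\mapsto ye^y$ on $[0,\infty)$. ($\lambda_i^*(\pi)$ is the maximizer over $\lambda\ge0$ of $d_i\pi(1-e^{-\lambda\tau})-\frac{\tilde\psi_i}{2}\lambda^2$.) When $\sum_i d_i>0$, for each $\varphi>0$ the equation $\pi=\varphi D_A(\pi)$ has a unique positive solution, denoted $\pi_A=\pi_A(\varphi)$ and called the equilibrium surrender-month return premium. $D_A'$ denotes the derivative of $D_A$ in $\pi$. The elasticity is $\frac{d\log\pi_A}{d\log\varphi}=\frac{\varphi}{\pi_A}\frac{d\pi_A}{d\varphi}$, with all $d_i,\tilde\psi_i,\tau$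 held fixed. *)

(* Defs.v *)
From HB Require Import structures.
From mathcomp Require Import all_boot all_order all_algebra.
From mathcomp Require Import all_classical all_reals all_analysis.

Set Implicit Arguments.
Unset Strict Implicit.
Unset Printing Implicit Defensive.

Import Order.TTheory GRing.Theory Num.Theory.
Import numFieldNormedType.Exports.

Local Open Scope classical_set_scope.
Local Open Scope ring_scope.

(* Principal branch on [0, +oo[, as the inverse of y |-> y e^y on [0, +oo[;
   the value at x < 0, where the set is empty, is the junk value 0. *)
Definition lambertW {R : realType} (x : R) : R :=
  xget 0 [set y : R | 0 <= y /\ y * expR y = x].

Definition lambda_star {R : realType} (tau d psi p : R) : R :=
  tau^-1 * lambertW (d * p * tau ^+ 2 / psi).

Definition DA {R : realType} (N : nat) (tau : R) (d psi : 'I_N -> R) (p : R) : R :=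
  \sum_(i < N) d i * expR (- (lambda_star tau (d i) (psi i) p * tau)).

(* The positive solution p of p = phi * D_A(p); it exists and is unique when
   tau, phi, psi_i > 0, d_i >= 0 and the d_i are not all zero (junk value 0
   if there is no positive solution). *)
Definition piA {R : realType} (N : nat) (tau : R) (d psi : 'I_N -> R) (phi : R) : R :=
  xget 0 [set p : R | 0 < p /\ p = phi * DA tau d psi p].

(* d log f / d log x = (x / f x) * f'(x) *)
Definition elasticity {R : realType} (f : R -> R) (x : R) : R :=
  x / f x * derive1 f x.

(* Main.v *)
(* On p > 0, D_A is positive and, by the inverse function theorem applied to
   y |-> y e^y, differentiable with negative derivative. Hence p |-> p / D_A(p)
   has positive derivative there and pi_A is its inverse, so that
   pi_A' = D_A^2 / (D_A - pi_A D_A') at pi_A(phi). Existence of pi_A(phi) is the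
   intermediate value theorem on [phi D_A(b), b] with b = phi \sum_i d_i; this
   interval avoids p = 0, where continuity of W would need a separate proof. *)
Require Import Defs.
From HB Require Import structures.
From mathcomp Require Import all_boot all_order all_algebra.
From mathcomp Require Import all_classical all_reals all_analysis.
From mathcomp Require Import ring.

Set Implicit Arguments.
Unset Strict Implicit.
Unset Printing Implicit Defensive.

Import Order.TTheory GRing.Theory Num.Theory.
Import numFieldNormedType.Exports.

Local Open Scope classical_set_scope.
Local Open Scope ring_scope.

(** * Lambert W as the inverse of y e^y: derivative and monotonicity *)

Section lambert.
Context {R : realType}.
Implicit Types x y : R.

Definition mul_expR y : R := y * expR y.

Lemma mul_expR_ge0 y : 0 <= y -> 0 <= mul_expR y.
Proof. by move=> y0; rewrite mulr_ge0// expR_ge0. Qed.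

Lemma mul_expR_lt y z : 0 <= y -> y < z -> mul_expR y < mul_expR z.
Proof. by move=> y0 yz; rewrite ltr_pM ?expR_ge0// ltr_expR. Qed.

Lemma mul_expR_inj y z : 0 <= y -> 0 <= z -> mul_expR y = mul_expR z -> y = z.
Proof.
move=> y0 z0 e; case: (ltgtP y z) => // h.
- by have := mul_expR_lt y0 h; rewrite e ltxx.
- by have := mul_expR_lt z0 h; rewrite e ltxx.
Qed.

Lemma is_derive_mul_expR y : is_derive y 1 mul_expR (expR y * (1 + y)).
Proof.
have -> : expR y * (1 + y) = y *: expR y + expR y *: (1 : R).
  by rewrite /GRing.scale/=; ring.
exact: is_deriveM.
Qed.

Lemma continuous_mul_expR : continuous mul_expR.
Proof.
move=> y; apply: differentiable_continuous; apply/derivable1_diffP.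
by have [] := is_derive_mul_expR y.
Qed.

Lemma mul_expRK y : 0 <= y -> lambertW (mul_expR y) = y.
Proof.
by move=> y0; apply: xget_unique => // z [z0 e]; apply: mul_expR_inj.
Qed.

(** Intermediate value theorem on [0, x]: since [expR x] is at least 1, the right end already
    satisfies x <= x e^x. *)
Lemma mul_expR_surj x : 0 <= x -> exists2 y, 0 <= y & mul_expR y = x.
Proof.
move=> x0; have xg : x <= mul_expR x by rewrite ler_peMr// -expR0 ler_expR.
have [||y] := @IVT R mul_expR 0 x x x0.
- exact/continuous_subspaceT/continuous_mul_expR.
- by rewrite {1}/mul_expR mul0r (min_idPl _) ?mul_expR_ge0// x0 le_max xg orbT.
- by rewrite in_itv/= => /andP[y0 _] e; exists y.
Qed.

(** Inverse function theorem at y = W(x). Positivity of x makes y positive, so a whole neighbourhood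
    of y lies where [mul_expRK] applies. Only the sign of the derivative is recorded, since the
    final formula refers to it through the derivative of D_A alone. *)
Lemma is_derive_lambertW x : 0 < x ->
  exists2 w, 0 < w & is_derive x 1 lambertW w.
Proof.
move=> x0; have [y y0 xE] := mul_expR_surj (ltW x0); rewrite -xE in x0 *.
have {}y0 : 0 < y.
  rewrite lt_neqAle y0 andbT; apply/eqP => y0E.
  by move: x0; rewrite -y0E /mul_expR mul0r ltxx.
have w0 : 0 < expR y * (1 + y) by rewrite mulr_gt0 ?expR_gt0 ?addr_gt0.
exists (expR y * (1 + y))^-1; first by rewrite invr_gt0.
apply: is_derive_inverse.
- near=> z; apply: mul_expRK; near: z.
  by near do apply: ltW; exact: lt_nbhsr.
- by near=> z; exact: continuous_mul_expR.
- exact: is_derive_mul_expR.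
- by rewrite gt_eqF.
Unshelve. all: by end_near. Qed.

Lemma lambertW_le : {in Num.nneg &, {homo @lambertW R : x y / x <= y}}.
Proof.
move=> x z; rewrite !nnegrE => /mul_expR_surj[y y0 <-] /mul_expR_surj[t t0 <-].
rewrite !mul_expRK//; case: (leP y t) => // ty.
by rewrite leNgt mul_expR_lt.
Qed.

End lambert.

(** * Positivity, monotonicity and derivative of D_A *)

Section equilibrium.
Context {R : realType} (N : nat) (tau : R) (d psi : 'I_N -> R).
Implicit Types p q phi v : R.
Hypotheses (tau_gt0 : 0 < tau) (d_ge0 : forall i, 0 <= d i).
Hypotheses (psi_gt0 : forall i, 0 < psi i) (sumd_gt0 : 0 < \sum_(i < N) d i).

Local Notation D := (DA tau d psi).
Local Notation pA := (piA tau d psi).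

Let c i := d i * tau ^+ 2 / psi i.

Let c_ge0 i : 0 <= c i.
Proof. by rewrite divr_ge0 ?mulr_ge0 ?sqr_ge0 ?d_ge0// ltW. Qed.

(** The factor [tau^-1] of [lambda_star] cancels the [tau] of the exponent, which leaves W evaluated
    at a linear function of p. *)
Lemma DAE p : D p = \sum_(i < N) d i * expR (- lambertW (c i * p)).
Proof.
apply: eq_bigr => i _; rewrite /lambda_star mulrAC mulVf ?gt_eqF// mul1r.
by congr (_ * expR (- lambertW _)); rewrite /c; ring.
Qed.

Lemma exists_d_gt0 : exists i, 0 < d i.
Proof.
apply/not_existsP => dN; move: sumd_gt0; rewrite big1 ?ltxx// => i _.
by apply/eqP; rewrite eq_le d_ge0 andbT leNgt; apply/negP/dN.
Qed.

(** Serves both D_A and minus its derivative: terms with d_i = 0 vanish in each, so strictness has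
    to come from some operator with d_i > 0. *)
Lemma sumr_gt0_supp_d (F : 'I_N -> R) : (forall i, 0 <= F i) ->
  (forall i, 0 < d i -> 0 < F i) -> 0 < \sum_(i < N) F i.
Proof.
have [i di] := exists_d_gt0; move=> F0 Fd.
by rewrite (bigD1 i)//= ltr_pwDl ?Fd ?sumr_ge0.
Qed.

Lemma DA_gt0 p : 0 < D p.
Proof.
rewrite DAE; apply: sumr_gt0_supp_d => i; first by rewrite mulr_ge0 ?expR_ge0.
by move=> di; rewrite mulr_gt0 ?expR_gt0.
Qed.

Lemma DA_le p q : 0 <= p -> p <= q -> D q <= D p.
Proof.
move=> p0 pq; rewrite !DAE; apply: ler_sum => i _.
have q0 : 0 <= q := le_trans p0 pq.
rewrite ler_wpM2l ?d_ge0// ler_expR lerN2.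
apply: lambertW_le; rewrite ?nnegrE.
- exact: mulr_ge0.
- exact: mulr_ge0.
- exact: ler_wpM2l.
Qed.

(** W is nonnegative, so each exponential is at most 1. This bound provides the upper end of the
    interval in the existence proof. *)
Lemma DA_le_sumd p : 0 <= p -> D p <= \sum_(i < N) d i.
Proof.
move=> p0; rewrite DAE; apply: ler_sum => i _.
rewrite ler_piMr// -expR0 ler_expR oppr_le0.
have cp0 : 0 <= c i * p by rewrite mulr_ge0.
by have [y y0 <-] := mul_expR_surj cp0; rewrite mul_expRK.
Qed.

Let is_derive_DA_term p i : 0 < p -> exists v : R,
  [/\ 0 <= v, 0 < d i -> 0 < v &
  is_derive p 1 (fun q => d i * expR (- lambertW (c i * q))) (- v)].
Proof.
move=> p0; have [di|] := ltP 0 (d i); last first.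
  (* Here [c i] = 0, and the chain rule would need W to be differentiable at 0; instead the whole
     term is the zero function. *)
  move=> di; have di0 : d i = 0 by apply/eqP; rewrite eq_le di d_ge0.
  exists 0; split => //; rewrite oppr0 di0.
  under eq_fun do rewrite mul0r.
  exact: is_derive_cst.
have ci : 0 < c i by rewrite divr_gt0 ?mulr_gt0 ?exprn_gt0.
have [w w0 dW] := is_derive_lambertW (mulr_gt0 ci p0).
pose e := expR (- lambertW (c i * p)).
have e0 : 0 < e := expR_gt0 _.
(* Minus the chain rule derivative, with w = W'(c_i p). *)
have v0 : 0 < d i * (e * (w * c i)) by do 3?[apply: mulr_gt0].
exists (d i * (e * (w * c i))); split => //; first exact: ltW.
have dc : is_derive p 1 (fun q : R => c i * q) (c i).
  rewrite -[X in is_derive _ _ _ X]mulr1.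
  exact: (@is_deriveZ _ _ _ (@id R) (c i) p 1 1).
have dWc : is_derive p 1 (fun q : R => lambertW (c i * q)) (w * c i).
  exact: (@is_derive1_comp _ lambertW (fun q => c i * q)).
have dE : is_derive p 1 (fun q : R => expR (- lambertW (c i * q)))
    (e * - (w * c i)).
  apply: (@is_derive1_comp _ expR (fun q : R => - lambertW (c i * q))).
rewrite -mulrN -mulrN.
exact: (@is_deriveZ _ _ _ (fun q : R => expR (- lambertW (c i * q))) (d i)).
Qed.

Lemma is_derive_DA p : 0 < p -> exists2 v : R, 0 < v & is_derive p 1 D (- v).
Proof.
move=> p0; have /choice[v vP] := fun i => is_derive_DA_term i p0.
exists (\sum_i v i).
  by apply: sumr_gt0_supp_d => i; case: (vP i).
rewrite -sumrN.
have -> : D = \sum_i (fun q => d i * expR (- lambertW (c i * q))).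
  by apply/funext => q; rewrite DAE fct_sumE.
by apply: is_derive_sum => i; case: (vP i).
Qed.

(** * Existence and uniqueness of the equilibrium *)

Let eq_set phi : set R := [set p : R | 0 < p /\ p = phi * D p].

(** Two solutions a < b would contradict the monotonicity of D_A: b = phi D(b) <= phi D(a) = a. *)
Lemma equilibrium_unique phi p q : 0 < phi ->
  eq_set phi p -> eq_set phi q -> q = p.
Proof.
move=> phi0.
suff main a b : eq_set phi a -> eq_set phi b -> b <= a.
  by move=> pP qP; apply/eqP; rewrite eq_le !main.
move=> [a0 aE] [b0 bE]; rewrite leNgt; apply/negP => ab.
have : b <= a by rewrite bE aE ler_pM2l// DA_le// ltW.
by rewrite leNgt ab.
Qed.

Lemma equilibrium_exists phi : 0 < phi -> exists p, eq_set phi p.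
Proof.
move=> phi0; pose b := phi * \sum_(i < N) d i.
have b0 : 0 < b by rewrite mulr_gt0.
pose a := phi * D b.
have a0 : 0 < a by rewrite mulr_gt0 ?DA_gt0.
have ab : a <= b by rewrite ler_pM2l// DA_le_sumd// ltW.
have [||p] := @IVT R (fun p => p - phi * D p) a b 0 ab.
- apply: derivable_within_continuous => x; rewrite in_itv/= => /andP[ax _].
  have [v _ [Dx _]] := is_derive_DA (lt_le_trans a0 ax).
  by apply: derivableB => //; exact: derivableZ.
(* At a = phi D(b) the function is nonpositive because a <= b gives D(b) <= D(a); at b it equals b -
   a >= 0. *)
- rewrite ge_min subr_le0 ler_pM2l// DA_le ?(ltW a0)//= le_max subr_ge0.
  by rewrite subr_ge0 -/a ab orbT.
- rewrite in_itv/= => /andP[ap _] /eqP; rewrite subr_eq0 => /eqP pE.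
  by exists p; split=> //; exact: lt_le_trans ap.
Qed.

Lemma piAP phi : 0 < phi -> 0 < pA phi /\ pA phi = phi * D (pA phi).
Proof. by move=> phi0; apply: (xgetPex 0 (equilibrium_exists phi0)). Qed.

(** Every p > 0 solves the equilibrium equation for phi = p / D(p), so uniqueness makes [pA] a left
    inverse of p / D(p). *)
Lemma piAK p : 0 < p -> pA (p / D p) = p.
Proof.
move=> p0; have phi0 : 0 < p / D p by rewrite divr_gt0 ?DA_gt0.
apply: (equilibrium_unique phi0); last exact: piAP.
by split=> //; rewrite mulfVK// gt_eqF ?DA_gt0.
Qed.

(** * Derivative of the equilibrium premium in phi *)

Lemma is_derive_div_DA p v : 0 < p -> is_derive p 1 D (- v) ->
  is_derive p 1 (fun q => q / D q) ((D p + p * v) / D p ^+ 2).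
Proof.
move=> p0 dD; have D0 : D p != 0 by rewrite gt_eqF ?DA_gt0.
have -> : (D p + p * v) / D p ^+ 2
    = p *: (- D p ^- 2 *: - v) + (D p)^-1 *: (1 : R).
  by rewrite /GRing.scale/=; field.
by apply: is_deriveM; exact: is_deriveV.
Qed.

Lemma is_derive_piA phi v : 0 < phi -> is_derive (pA phi) 1 D (- v) -> 0 < v ->
  is_derive phi 1 pA ((D (pA phi) + pA phi * v) / D (pA phi) ^+ 2)^-1.
Proof.
move=> phi0 dD v0; have [p0 pE] := piAP phi0; set p := pA phi in dD p0 pE *.
have D0 := DA_gt0 p.
have phiE : phi = p / D p by rewrite [X in X / _]pE mulfK ?gt_eqF.
rewrite [X in is_derive X]phiE.
apply: (@is_derive_inverse _ (fun q => q / D q)).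
- by near=> q; apply: piAK; near: q; exact: lt_nbhsr.
(* Continuity is required on a neighbourhood of p; it follows from differentiability at each nearby
   q, which is still positive. *)
- near=> q; have q0 : 0 < q by near: q; exact: lt_nbhsr.
  have [u _ dDq] := is_derive_DA q0.
  have [dq _] := is_derive_div_DA q0 dDq.
  by apply: differentiable_continuous; apply/derivable1_diffP.
- exact: is_derive_div_DA.
- by rewrite gt_eqF// divr_gt0 ?exprn_gt0// addr_gt0 ?mulr_gt0.
Unshelve. all: by end_near. Qed.

End equilibrium.

Theorem corollary1 (R : realType) (N : nat) (tau : R) (d psi : 'I_N -> R)
    (tau_gt0 : 0 < tau) (d_ge0 : forall i, 0 <= d i)
    (psi_gt0 : forall i, 0 < psi i) (sumd_gt0 : 0 < \sum_(i < N) d i)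
    (phi : R) (phi_gt0 : 0 < phi) :
  let D := DA tau d psi in
  let pA := piA tau d psi in
  [/\ derivable D (pA phi) 1,
      derive1 D (pA phi) < 0,
      derivable pA phi 1,
      elasticity pA phi = 1 / (1 + phi * `|derive1 D (pA phi)|)
    & 0 < elasticity pA phi < 1].
Proof.
move=> D pA; have [p0 pE] := piAP tau_gt0 d_ge0 psi_gt0 sumd_gt0 phi_gt0.
rewrite -/D -/pA in p0 pE.
have [v v0 dD] := is_derive_DA tau_gt0 d_ge0 psi_gt0 sumd_gt0 p0.
have dp := is_derive_piA tau_gt0 d_ge0 psi_gt0 sumd_gt0 phi_gt0 dD v0.
have D'E : derive1 D (pA phi) = - v by rewrite derive1E derive_val.
have D0 : 0 < D (pA phi) by exact: DA_gt0.
have elE : elasticity pA phi = 1 / (1 + phi * v).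
  rewrite /elasticity derive1E derive_val -/D -/pA.
  (* Generalizing [D (pA phi)] first lets [pA phi] be replaced by [phi * Dp] everywhere without
     reappearing on the right; what remains is a rational identity in phi, [Dp] and v. *)
  move: (D (pA phi)) D0 pE => Dp Dp0 ->.
  have Dpv : Dp + phi * Dp * v != 0.
    by rewrite gt_eqF// addr_gt0 ?mulr_gt0.
  have phiv1 : 1 + phi * v != 0 by rewrite gt_eqF// addr_gt0 ?mulr_gt0.
  by field; rewrite phiv1 Dpv !gt_eqF.
have phiv : 0 < phi * v by rewrite mulr_gt0.
split.
- by case: dD.
- by rewrite D'E oppr_lt0.
- by case: dp.
- by rewrite D'E normrN gtr0_norm.
- by rewrite elE div1r invr_gt0 invf_lt1 ?ltrDl ?addr_gt0.
Qed.
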